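(* In the setting of the context, assume $\sum_{i=0}^N\mu_i<\infty$ and $\delta<\infty$, where $$\delta=\sup_{1\le n\in E}\Big(\sum_{i=1}^n\frac1{\mu_ia_i}\Big)\Big(\sum_{j=n}^N\mu_j\Big),$$ and let $\lambda_1=\inf\{D(f):\mu(f)=0,\ \mu(f^2)=1\}$. Write $\varphi_0=0$ and $\varphi_i=\sum_{0\le j\le i-1}(\mu_jb_j)^{-1}$ for $1\le i\in E$. (1) Define $f_1=\sqrt\varphi$, $f_n=\bar f_{n-1}II(\bar f_{n-1})$ for $n\ge2$, and $\eta_n=\sup_{1\le i\in E}I_i(\bar f_n)$. Then $\eta_n$ is decreasing in $n$ and $\lambda_1\ge\eta_n^{-1}\ge(4\delta)^{-1}$ for all $n\ge1$. (2) For fixed $m\in E$, $m\ge1$, define $f_1^{(m)}=\varphi_{\cdot\wedge m}$ and $f_n^{(m)}=\big[\bar f_{n-1}^{(m)}II\big(\bar f_{n-1}^{(m)}\big)\big](\cdot\wedge m)$ for $n\ge2$, and then $$\eta_n'=\sup_{1\le m\in E}\ \inf_{1\le i\in E}I_i\big(\bar f_n^{(m)}\big),\qquad \bar\eta_n=\sup_{1\le m\in E}\frac{\mu\big((\bar f_n^{(m)})^2\big)}{D\big(f_n^{(m)}\big)},\qquad n\ge1.$$ Then $\eta_n'$ is increasing in $n$ and $\eta_n'^{-1}\ge\bar\eta_n^{-1}\ge\lambda_1$ for all $n\ge1$.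
   Context: $E=\{i\in\mathbb Z:0\le i<N+1\}$, $1\le N\le\infty$; birth rates $b_i>0$ for $0\le i<N$ and $b_N=0$ if $N<\infty$; death rates $a_i>0$ for $1\le i\in E$, $a_0=0$. $\mu_0=1$, $\mu_n=\frac{b_0\cdots b_{n-1}}{a_1\cdots a_n}$; $\mu(f)=\sum_{i\in E}\mu_if_i$; $\pi=\mu/\sum_{k\in E}\mu_k$; $\bar f=f-\pi(f)$. $D(f)=\sum_{1\le i<N+1}\mu_ia_i(f_i-f_{i-1})^2$ with domain $\{f\in L^2(\mu):D(f)<\infty\}$. $I_i(f)=\frac1{\mu_ia_i(f_i-f_{i-1})}\sum_{j=i}^N\mu_jf_j$ for $1\le i\in E$ (with $1/0=\infty$). The notation $gII(g)$ stands for the function with value $0$ at $0$ and $\big[gII(g)\big](i)=\sum_{j=1}^i\frac1{\mu_ja_j}\sum_{k=j}^N\mu_kg_k$ for $1\le i\in E$. $h(\cdot\wedge m)$ is the function $i\mapsto h(i\wedge m)$. ''Increasing/decreasing'' are in the weak sense. *)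

(* Defs.v *)
From mathcomp Require Import all_boot all_order all_algebra.
From mathcomp Require Import all_classical all_reals all_analysis.

Set Implicit Arguments.
Unset Strict Implicit.
Unset Printing Implicit Defensive.

Import Order.TTheory GRing.Theory Num.Theory.
Import numFieldNormedType.Exports.

Local Open Scope classical_set_scope.
Local Open Scope ring_scope.

(* A bound N in {0, 1, ..., oo} is an [option nat], with [None] for oo.
   [state N i] is i < N + 1, i.e. i \in E; [nontop N i] is i < N. *)
Definition state (N : option nat) (i : nat) : bool :=
  if N is Some n then (i <= n)%N else true.

Definition nontop (N : option nat) (i : nat) : bool :=
  if N is Some n then (i < n)%N else true.

Section BirthDeath.
Variables (R : realType) (N : option nat) (a b : nat -> R).

(* Functions on E are represented by functions on nat whose values outside E
   are never used. *)
Implicit Types f g h : nat -> R.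

(* The series is the limit in \bar R of its partial sums, over the indices
   in E; it is a finite sum when N is finite. *)
Definition sumE (m : nat) (u : nat -> R) : \bar R :=
  (\sum_(m <= i <oo | state N i) (u i)%:E)%E.

Definition mu (n : nat) : R :=
  (\prod_(0 <= i < n) b i) / (\prod_(1 <= i < n.+1) a i).

Definition mass : \bar R := sumE 0 mu.

Definition mu_of f : \bar R := sumE 0 (fun i => mu i * f i).

Definition prob (i : nat) : R := mu i / fine mass.

Definition prob_of f : R := fine (sumE 0 (fun i => prob i * f i)).

Definition bar f : nat -> R := fun i => f i - prob_of f.

Definition D f : \bar R :=
  sumE 1 (fun i => mu i * a i * (f i - f i.-1) ^+ 2).

Definition delta : \bar R :=
  ereal_sup [set ((\sum_(1 <= i < n.+1) (mu i * a i)^-1)%:E * sumE n mu)%E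
            | n in [set n | (1 <= n)%N && state N n]].

Definition lambda1 : \bar R :=
  ereal_inf [set D f | f in [set f | mu_of f = 0%E
                                   /\ mu_of (fun i => f i ^+ 2) = 1%E
                                   /\ (D f < +oo)%E]].

(* The inverse is that of \bar R, for which 0^-1 = +oo. *)
Definition I_ (i : nat) f : \bar R :=
  (((mu i * a i * (f i - f i.-1))%:E)^-1
   * sumE i (fun j => (mu j * f j)%R))%E.

Definition gII g : nat -> R := fun i =>
  \sum_(1 <= j < i.+1) (mu j * a j)^-1 * fine (sumE j (fun k => mu k * g k)).

Definition stop (m : nat) h : nat -> R := fun i => h (minn i m).

Definition phi (i : nat) : R := \sum_(0 <= j < i) (mu j * b j)^-1.

(* The sequences are indexed from n = 1; index 0 repeats the first term. *)
Definition f_ (n : nat) : nat -> R :=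
  iter n.-1 (fun f => gII (bar f)) (fun i => Num.sqrt (phi i)).

Definition fm_ (m n : nat) : nat -> R :=
  iter n.-1 (fun f => stop m (gII (bar f))) (stop m phi).

Definition eta (n : nat) : \bar R :=
  ereal_sup [set I_ i (bar (f_ n)) | i in [set i | (1 <= i)%N && state N i]].

Definition eta' (n : nat) : \bar R :=
  ereal_sup
    [set ereal_inf [set I_ i (bar (fm_ m n))
                   | i in [set i | (1 <= i)%N && state N i]]
    | m in [set m | (1 <= m)%N && state N m]].

Definition etabar (n : nat) : \bar R :=
  ereal_sup
    [set (mu_of (fun i => (bar (fm_ m n) i ^+ 2)%R) / D (fm_ m n))%E
    | m in [set m | (1 <= m)%N && state N m]].

End BirthDeath.

(* Main.v *)
(** For F = gII (bar f) the increment F_i - F_(i-1) is the tail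
    sum_(j >= i) mu_j (bar f)_j divided by mu_i a_i, so I_i (bar f_n) is the
    ratio of the i-th increments of f_(n+1) and f_n. Tails are linear in f
    and nonnegative when f is nondecreasing; hence a bound
    I_i (bar f_n) <= c for all i, or >= c, passes to f_(n+1), because c f_n - f_(n+1)
    or its opposite is nondecreasing. This is the monotonicity of eta and eta'.

    Such an upper bound c for an increasing g yields 1 <= c D(f) for every
    normalized f, by (f_j - f_i)^2 <= (g_j - g_i) sum_(i < k <= j)
    (f_k - f_(k-1))^2 / (g_k - g_(k-1)) inserted in the variance. For
    f_1 = sqrt phi the bound c = 4 delta comes from summation by parts and
    phi_n sum_(j >= n) mu_j <= delta. For the stopped sequence, summation by
    parts writes the variance of f as the sum of tails times increments,
    which is at least c D(f); and bar f is a test function for lambda1. *)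

Require Import Defs.
From mathcomp Require Import all_boot all_order all_algebra.
From mathcomp Require Import all_classical all_reals all_analysis.
From mathcomp Require Import ring lra.
Import Order.TTheory GRing.Theory Num.Theory.
Import numFieldNormedType.Exports.
Local Open Scope ring_scope.
Set Implicit Arguments.
Unset Strict Implicit.
Unset Printing Implicit Defensive.

(** * Series over E reduced to limits of real partial sums *)

Section SumE.
Variables (R : realType) (N : option nat) (u : nat -> R).
Hypothesis u_out : forall i, ~~ state N i -> u i = 0.

Lemma partial_sumE (k n : nat) :
  (\sum_(k <= i < n | state N i) (u i)%:E = (\sum_(k <= i < n) u i)%:E)%E.
Proof.
rewrite sumEFin big_mkcond; congr EFin; apply: eq_bigr => i _.
by case: ifPn => // /u_out ->.
Qed.

(** A series started at [k] is the full limit minus a finite head, so convergence is only ever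
    discussed for series started at 0. *)
Lemma sumE_cvg (k : nat) (l : R) :
  (series u @ \oo --> l)%classic ->
  sumE N k u = (l - \sum_(0 <= i < k) u i)%:E.
Proof.
move=> ul; apply/cvg_lim => //; rewrite (_ : (fun n => _) =
   EFin \o (fun n => \sum_(k <= i < n) u i)); last first.
  by apply/funext => n /=; rewrite partial_sumE.
apply: cvg_EFin; first by apply: nearW.
have : (series u n - \sum_(0 <= i < k) u i @[n --> \oo] -->
         l - \sum_(0 <= i < k) u i)%classic.
  by apply: cvgB => //; apply: cvg_cst.
apply: cvg_trans; apply: near_eq_cvg; near=> n => /=.
rewrite /series/= (@big_cat_nat _ _ _ k) //=; last by near: n; apply: nbhs_infty_ge.
by rewrite addrAC subrr add0r.
Unshelve. all: by end_near. Qed.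

Lemma sumE_ge_partial (k n : nat) :
  (forall i, 0 <= u i) -> ((\sum_(k <= i < n) u i)%:E <= sumE N k u)%E.
Proof.
move=> u0; rewrite -partial_sumE; apply: nneseries_lim_ge => i _ _.
by rewrite lee_fin.
Qed.

Lemma is_cvg_sumE :
  (forall i, 0 <= u i) -> (sumE N 0 u < +oo)%E -> cvgn (series u).
Proof.
move=> u0 fin; apply: nondecreasing_is_cvgn.
  by apply: nondecreasing_series => i _ _.
exists (fine (sumE N 0 u)) => _ [n _ <-]; rewrite -lee_fin fineK.
  exact: sumE_ge_partial.
have := sumE_ge_partial 0 0 u0; rewrite big_geq // => s0.
by rewrite ge0_fin_numE.
Qed.

End SumE.

(** * Finite-sum identities and the inductive step of Cauchy-Schwarz *)

Section FiniteSums.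
Variable R : realFieldType.
Implicit Types m F G f g : nat -> R.

(** The covariance of [F] and [G] under unnormalized weights as a double sum; the case [F = G] is
    the variance. *)
Lemma sum_mul_increments m F G (n : nat) :
  \sum_(0 <= i < n) \sum_(0 <= j < n) m i * m j * ((F j - F i) * (G j - G i)) =
  2 * ((\sum_(0 <= i < n) m i) * (\sum_(0 <= i < n) m i * (F i * G i)) -
       (\sum_(0 <= i < n) m i * F i) * (\sum_(0 <= i < n) m i * G i)).
Proof.
set M := \sum_(_ <= _ < _) m _; set A := \sum_(_ <= _ < _) _ * (_ * _).
set B := \sum_(_ <= _ < _) m _ * F _; set C := \sum_(_ <= _ < _) m _ * G _.
transitivity (\sum_(0 <= i < n) (m i * A + m i * (F i * G i) * M
    - m i * G i * B - m i * F i * C)).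
  apply: eq_bigr => i _; rewrite !mulr_sumr -big_split/= -!sumrB.
  by apply: eq_bigr => j _; ring.
rewrite !sumrB big_split/= -!mulr_suml -/M -/A -/B -/C; ring.
Qed.

Lemma summation_by_parts m F (n : nat) :
  \sum_(0 <= j < n) m j * F j = (\sum_(0 <= j < n) m j) * F n -
   \sum_(1 <= k < n.+1) (\sum_(0 <= j < k) m j) * (F k - F k.-1).
Proof.
rewrite big_add1 /=; elim: n => [|n IH]; first by rewrite !big_geq // mul0r subr0.
rewrite big_nat_recr //= IH [X in _ = _ - X]big_nat_recr //=.
rewrite (@big_nat_recr _ _ _ n 0 m) //=; ring.
Qed.

(** Appends one term to a Cauchy-Schwarz bound. With [t = y ^+ 2 / u], the cross term satisfies
    [(x * y) ^+ 2 <= (A * t) * (u * P)], and the arithmetic-geometric mean inequality bounds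
    [2 * x * y] by [A * t + u * P]. *)
Lemma cauchy_step (x y A P u : R) : 0 <= A -> 0 <= P -> 0 < u -> x ^+ 2 <= A * P ->
  (x + y) ^+ 2 <= (A + u) * (P + y ^+ 2 / u).
Proof.
move=> A0 P0 u0 xAP; set t := y ^+ 2 / u.
have yE : y ^+ 2 = u * t by rewrite mulrC divfK // gt_eqF.
have u0' := ltW u0.
have t0 : 0 <= t by apply: divr_ge0 => //; apply: sqr_ge0.
have s0 : 0 <= A * t + u * P by apply: addr_ge0; apply: mulr_ge0.
suff : 2 * x * y <= A * t + u * P.
  have -> : (x + y) ^+ 2 = x ^+ 2 + 2 * x * y + y ^+ 2 by ring.
  have -> : (A + u) * (P + t) = A * P + (A * t + u * P) + u * t by ring.
  by rewrite yE => ?; rewrite lerD2r lerD.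
apply: le_trans (ler_norm _) _; rewrite -(ler_sqr (normr_ge0 _) s0).
rewrite real_normK ?num_real // !exprMn yE.
have : x ^+ 2 * (u * t) <= A * P * (u * t) by apply: ler_wpM2r => //; apply: mulr_ge0.
have := sqr_ge0 (A * t - u * P); lra.
Qed.

End FiniteSums.

Lemma cvg_series_eventually0 (R : realType) (u : nat -> R) (r : nat) :
  (forall i, (r <= i)%N -> u i = 0) ->
  (series u @ \oo --> \sum_(0 <= i < r) u i)%classic.
Proof.
move=> u0; apply: cvg_near_cst; near=> n.
rewrite /series/= (@big_cat_nat _ _ _ r) //=; last first.
  by near: n; apply: nbhs_infty_ge.
rewrite [X in _ + X]big_seq [X in _ + X]big1 ?addr0 // => i.
by rewrite mem_index_iota => /andP[/u0].
Unshelve. all: by end_near. Qed.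

(** * Weights, conductances and the function [phi] *)

Section Chain.
Variables (R : realType) (N : option nat) (a b : nat -> R).
Hypothesis b_gt0 : forall i : nat, nontop N i -> 0 < b i.
Hypothesis b_top : forall n : nat, N = Some n -> b n = 0.
Hypothesis a_gt0 : forall i : nat, (1 <= i)%N -> state N i -> 0 < a i.

Local Notation st := (state N).
Local Notation m := (mu a b).

Lemma state_le (i j : nat) : (i <= j)%N -> st j -> st i.
Proof. by rewrite /state; case: N => // n; apply: leq_trans. Qed.

Lemma state_S (i : nat) : st i.+1 = nontop N i.
Proof. by []. Qed.

Lemma mu_gt0 (i : nat) : st i -> 0 < m i.
Proof.
move=> sti; rewrite /mu divr_gt0 // big_seq_cond; apply: prodr_gt0 => j;
  rewrite mem_index_iota andbT => /andP[j1 j2].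
- by apply: b_gt0; rewrite -state_S (state_le j2).
- by apply: a_gt0 => //; rewrite (@state_le _ i).
Qed.

(* So the restriction of sums to E is immaterial, the summands carrying a factor mu. *)
Lemma mu_out (i : nat) : ~~ st i -> m i = 0.
Proof.
rewrite /state; case EN : N => [n|//]; rewrite -ltnNge => ni.
by rewrite /mu (bigD1_seq n) ?mem_index_iota ?iota_uniq //= b_top // !mul0r.
Qed.

Lemma mu_ge0 (i : nat) : 0 <= m i.
Proof. by case: (boolP (st i)) => [/mu_gt0/ltW//|/mu_out ->]. Qed.

(* The conductance of the edge {i - 1, i}. *)
Definition cond (i : nat) : R := m i * a i.

Lemma cond_gt0 (i : nat) : (1 <= i)%N -> st i -> 0 < cond i.
Proof. by move=> i1 sti; rewrite mulr_gt0 ?mu_gt0 ?a_gt0. Qed.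

Lemma cond_out (i : nat) : ~~ st i -> cond i = 0.
Proof. by move=> /mu_out mi; rewrite /cond mi mul0r. Qed.

(** Detailed balance; it rewrites [phi] with the death rates that occur in [delta]. *)
Lemma mu_bE (i : nat) : st i.+1 -> m i * b i = cond i.+1.
Proof.
move=> sti; have ai := a_gt0 (ltn0Sn i) sti.
rewrite /cond /mu (big_nat_recr i.+1) //= [in RHS]big_nat_recr //= invfM.
by rewrite -!mulrA mulVf ?gt_eqF // mulr1 [b i * _]mulrC.
Qed.

Lemma phiS (i : nat) : st i.+1 -> phi a b i.+1 = phi a b i + (cond i.+1)^-1.
Proof. by move=> sti; rewrite /phi big_nat_recr //= mu_bE. Qed.

Lemma phi0 : phi a b 0 = 0. Proof. by rewrite /phi big_geq. Qed.

Lemma phi_gt0 (i : nat) : (1 <= i)%N -> st i -> 0 < phi a b i.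
Proof.
case: i => // i _; elim: i => [|i IH] sti; rewrite phiS //.
  by rewrite phi0 add0r invr_gt0 cond_gt0.
by rewrite addr_gt0 ?IH ?invr_gt0 ?cond_gt0 // (state_le (leqnSn _)).
Qed.

Lemma mul_mu_out (g : nat -> R) (i : nat) : ~~ st i -> m i * g i = 0.
Proof. by move=> /mu_out ->; rewrite mul0r. Qed.

(** * Summability with respect to mu *)

Definition summable_mu (g : nat -> R) : Prop :=
  cvgn (series (fun i => m i * g i)).

Hypothesis mass_fin : (mass N a b < +oo)%E.

Definition Z : R := fine (mass N a b).

Lemma cvg_mu : (series m @ \oo --> Z)%classic.
Proof.
have c : cvgn (series m) := is_cvg_sumE mu_out mu_ge0 mass_fin.
by rewrite /Z /mass (sumE_cvg mu_out 0 c) big_geq // subr0.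
Qed.

Lemma sum_mu_le_Z (n : nat) : \sum_(0 <= i < n) m i <= Z.
Proof.
rewrite -(cvg_lim _ cvg_mu) //; apply: (@nondecreasing_cvgn_le _ (series m)).
  by apply: nondecreasing_series => i _ _; apply: mu_ge0.
by apply/cvg_ex; eexists; apply: cvg_mu.
Qed.

Lemma Z_gt0 : 0 < Z.
Proof.
apply: lt_le_trans (sum_mu_le_Z 1); rewrite big_nat1; apply: mu_gt0.
by rewrite /state; case: N.
Qed.

Lemma summable_cst (c : R) : summable_mu (fun=> c).
Proof.
apply/cvg_ex; exists (Z * c).
rewrite (_ : series _ = fun n => series m n * c); last first.
  by apply/funext => n; rewrite /series/= mulr_suml.
by apply: cvgM; [apply: cvg_mu|apply: cvg_cst].
Qed.

Lemma summable_lin (c d : R) (f g : nat -> R) : summable_mu f -> summable_mu g ->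
  summable_mu (fun i => c * f i + d * g i) /\
  limn (series (fun i => m i * (c * f i + d * g i))) =
   c * limn (series (fun i => m i * f i)) + d * limn (series (fun i => m i * g i)).
Proof.
move=> sf sg; suff H : (series (fun i => m i * (c * f i + d * g i)) @ \oo -->
   c * limn (series (fun i => m i * f i)) + d * limn (series (fun i => m i * g i)))%classic.
  by split; [apply/cvg_ex; eexists; apply: H|apply/cvg_lim].
rewrite (_ : series _ = fun n => c * series (fun i => m i * f i) n +
    d * series (fun i => m i * g i) n); last first.
  apply/funext => n; rewrite /series/= !mulr_sumr -big_split/=.
  by apply: eq_bigr => i _; ring.
by apply: cvgD; apply: cvgM => //; apply: cvg_cst.
Qed.

Lemma summable_le (f g : nat -> R) : (forall i, st i -> 0 <= f i <= g i) ->
  summable_mu g -> summable_mu f.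
Proof.
move=> fg; apply: series_le_cvg => i; case: (boolP (st i)) => sti;
  rewrite ?(mul_mu_out _ sti) //.
- by have /andP[f0 _] := fg _ sti; rewrite mulr_ge0 ?mu_ge0.
- by have /andP[f0 /(le_trans f0) g0] := fg _ sti; rewrite mulr_ge0 ?mu_ge0.
- by have /andP[_ fgi] := fg _ sti; rewrite ler_wpM2l ?mu_ge0.
Qed.

Lemma prob_ofE (f : nat -> R) : summable_mu f ->
  prob_of N a b f = limn (series (fun i => m i * f i)) / Z.
Proof.
move=> sf; rewrite /prob_of (@sumE_cvg _ _ _ _ 0 (limn (series (fun i => m i * f i)) / Z)).
- by rewrite big_geq ?subr0.
- by move=> i /mu_out mi; rewrite /prob mi !mul0r.
rewrite (_ : series (fun i => prob N a b i * f i) =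
    fun n => series (fun i => m i * f i) n / Z); last first.
  apply/funext => n; rewrite /series/= mulr_suml; apply: eq_bigr => i _.
  by rewrite /prob mulrAC.
by apply: cvgM => //; apply: cvg_cst.
Qed.

(** * Centered functions and the sign of their tails *)

Local Notation br := (bar N a b).

Lemma cvg_bar (f : nat -> R) : summable_mu f ->
  (series (fun i => m i * br f i) @ \oo --> (0 : R))%classic.
Proof.
move=> sf; rewrite (_ : series _ = fun n => series (fun i => m i * f i) n -
   series m n * prob_of N a b f); last first.
  apply/funext => n; rewrite /series/= mulr_suml -sumrB.
  by apply: eq_bigr => i _; rewrite /bar mulrBr.
rewrite [0](_ : _ = limn (series (fun i => m i * f i)) - Z * prob_of N a b f).
  by apply: cvgB => //; apply: cvgM; [apply: cvg_mu|apply: cvg_cst].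
by rewrite prob_ofE // mulrC divfK ?subrr // gt_eqF ?Z_gt0.
Qed.

(* As bar f has total mass 0, this is the sum over j >= i. *)
Definition tail (f : nat -> R) (i : nat) : R :=
  - \sum_(0 <= j < i) m j * br f j.

Lemma sumE_bar (f : nat -> R) (i : nat) : summable_mu f ->
  sumE N i (fun j => m j * br f j) = (tail f i)%:E.
Proof.
move=> sf; rewrite (sumE_cvg (mul_mu_out _) _ (cvg_bar sf)).
by rewrite sub0r.
Qed.

Lemma tail_lin (c d : R) (f g : nat -> R) (i : nat) :
  summable_mu f -> summable_mu g ->
  tail (fun i => c * f i + d * g i) i = c * tail f i + d * tail g i.
Proof.
move=> sf sg; have [s l] := summable_lin c d sf sg.
rewrite /tail !mulrN -opprD; congr (- _); rewrite !mulr_sumr -big_split/=.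
by apply: eq_bigr => j _; rewrite /bar !prob_ofE // l; ring.
Qed.

Definition nondecrE (g : nat -> R) : Prop :=
  forall i, st i.+1 -> g i <= g i.+1.

Lemma nondecrE_le (g : nat -> R) (i j : nat) :
  nondecrE g -> (i <= j)%N -> st j -> g i <= g j.
Proof.
move=> gi; elim: j => [|j IH]; first by rewrite leqn0 => /eqP ->.
rewrite leq_eqVlt => /predU1P[-> //|ij] stj.
by apply: le_trans (gi _ stj); apply: IH => //; apply: state_le stj.
Qed.

(** [br f] is nondecreasing with total mass 0. If it is negative at [i], every term of the head is
    nonpositive; otherwise every later term is nonnegative, so the head lies below the full sum,
    which is 0. *)
Lemma tail_ge0 (f : nat -> R) (i : nat) :
  summable_mu f -> nondecrE f -> 0 <= tail f i.
Proof.
move=> sf fi; rewrite /tail oppr_ge0; have c := cvg_bar sf.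
have [|/norP[/negbNE sti gi0]] := boolP (~~ st i || (0 <= br f i)); last first.
  rewrite -ltNge in gi0.
  rewrite big_seq; apply: sumr_le0 => j; rewrite mem_index_iota => /andP[_ ji].
  apply: mulr_ge0_le0; first exact: mu_ge0.
  by apply: le_trans (ltW gi0); apply: lerB => //; apply: nondecrE_le => //; apply: ltnW.
move=> H; rewrite -[leRHS](cvg_lim _ c) //; apply: limr_ge; first by apply/cvg_ex; exists 0.
near=> n; rewrite /series/= [leRHS](@big_cat_nat _ _ _ i) //=; last first.
  by near: n; apply: nbhs_infty_ge.
rewrite lerDl big_seq; apply: sumr_ge0 => j; rewrite mem_index_iota => /andP[ij _].
have [stj|stj] := boolP (st j); last by rewrite mul_mu_out.
apply: mulr_ge0; first exact: mu_ge0.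
move: H; rewrite (state_le ij stj) /= => H.
by apply: le_trans H _; apply: lerB => //; apply: nondecrE_le.
Unshelve. all: by end_near. Qed.

(** Strictness comes from a single term: the one at 0, negative because [f 0 < f 1 <= f i], when
    [br f i <= 0]; the one at [i] itself when [br f i > 0]. *)
Lemma tail_gt0 (f : nat -> R) (i : nat) : summable_mu f -> nondecrE f ->
  f 0%N < f 1%N -> (1 <= i)%N -> st i -> 0 < tail f i.
Proof.
move=> sf fi f01 i1 sti.
have [gi0|gi0] := lerP (br f i) 0.
  rewrite /tail oppr_gt0 big_ltn // ltr_nwDl //; last first.
    rewrite big_seq; apply: sumr_le0 => j; rewrite mem_index_iota => /andP[_ ji].
    apply: mulr_ge0_le0; first exact: mu_ge0.
    by apply: le_trans gi0; apply: lerB => //; apply: nondecrE_le => //; apply: ltnW.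
  rewrite pmulr_rlt0; last by apply: mu_gt0; apply: state_le sti.
  apply: lt_le_trans gi0; rewrite ltrD2r; apply: lt_le_trans f01 _.
  exact: nondecrE_le.
have := tail_ge0 i.+1 sf fi; rewrite /tail big_nat_recr //= opprD subr_ge0.
by apply: lt_le_trans; apply: mulr_gt0 => //; apply: mu_gt0.
Qed.

Definition incrE (g : nat -> R) : Prop :=
  forall i, st i.+1 -> g i < g i.+1.

Lemma incrE_nondecrE (g : nat -> R) : incrE g -> nondecrE g.
Proof. by move=> gi i sti; apply/ltW/gi. Qed.

Lemma energy_ge0 (f : nat -> R) (i : nat) : 0 <= m i * a i * (f i - f i.-1) ^+ 2.
Proof.
case: i => [|i]; first by rewrite subrr expr2 !mulr0.
apply: mulr_ge0 (sqr_ge0 _).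
by have [sti|/cond_out ci] := boolP (st i.+1); [apply/ltW/cond_gt0|rewrite -/(cond _) ci].
Qed.

Lemma energy_out (f : nat -> R) (i : nat) :
  ~~ st i -> m i * a i * (f i - f i.-1) ^+ 2 = 0.
Proof. by move=> /cond_out ci; rewrite -/(cond i) ci mul0r. Qed.

(** * From an upper bound on the tails of g to a lower bound on D(f) *)

Section Variational.
Variables (c : R) (f g : nat -> R).
Hypothesis c_ge0 : 0 <= c.
Hypothesis g_sum : summable_mu g.
Hypothesis g_incr : incrE g.
Hypothesis g_tail : forall k, st k.+1 ->
  tail g k.+1 <= c * (cond k.+1 * (g k.+1 - g k)).

(** The value 0 off E, where the increments of [g] have no prescribed sign, makes [Q] nondecreasing
    on all of nat. *)
Let q (k : nat) : R := if st k then (f k - f k.-1) ^+ 2 / (g k - g k.-1) else 0.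
Let Q (n : nat) : R := \sum_(0 <= k < n) q k.+1.

Let q_ge0 k : 0 <= q k.+1.
Proof.
rewrite /q; case: ifP => //= stk; rewrite divr_ge0 ?sqr_ge0 // subr_ge0 ltW //.
exact: g_incr.
Qed.

Let Q_homo (i j : nat) : (i <= j)%N -> Q i <= Q j.
Proof. by apply: nondecreasing_series => k _ _; apply: q_ge0. Qed.

(** Cauchy-Schwarz after splitting each increment of [f] as the square root of the increment of [g]
    times a quotient whose square is [q]. *)
Lemma cauchy_increments (i j : nat) : (i <= j)%N -> st j ->
  (f j - f i) ^+ 2 <= (g j - g i) * (Q j - Q i).
Proof.
elim: j => [|j IH]; first by rewrite leqn0 => /eqP ->; rewrite !subrr expr2 !mul0r.
rewrite leq_eqVlt => /predU1P[-> _|]; first by rewrite !subrr expr2 !mul0r.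
rewrite ltnS => ij stj; have stj' := state_le (leqnSn j) stj.
have -> : f j.+1 - f i = (f j - f i) + (f j.+1 - f j) by ring.
have -> : g j.+1 - g i = (g j - g i) + (g j.+1 - g j) by ring.
have -> : Q j.+1 - Q i = (Q j - Q i) + (f j.+1 - f j) ^+ 2 / (g j.+1 - g j).
  by rewrite /Q [in LHS]big_nat_recr //= /q stj /=; ring.
apply: cauchy_step; last exact: IH.
- by rewrite subr_ge0; apply: nondecrE_le => //; apply: incrE_nondecrE.
- by rewrite subr_ge0 Q_homo.
- by rewrite subr_gt0 g_incr.
Qed.

(* The variance is the double sum of squared increments of f; after Cauchy it
   becomes the covariance of g and Q, which summation by parts turns into
   a sum of tails of g against the increments of Q. *)
Lemma partial_variance_le (n : nat) :
  (\sum_(0 <= i < n) m i) * (\sum_(0 <= i < n) m i * (f i * f i)) -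
    (\sum_(0 <= i < n) m i * f i) * (\sum_(0 <= i < n) m i * f i) <=
  (\sum_(0 <= i < n) m i) *
    (c * \sum_(1 <= k < n.+1) cond k * (f k - f k.-1) ^+ 2).
Proof.
have M0 : 0 <= \sum_(0 <= i < n) m i by apply: sumr_ge0 => i _; apply: mu_ge0.
set h := br g.
have step1 : (\sum_(0 <= i < n) m i) * (\sum_(0 <= i < n) m i * (f i * f i)) -
    (\sum_(0 <= i < n) m i * f i) * (\sum_(0 <= i < n) m i * f i) <=
    (\sum_(0 <= i < n) m i) * (\sum_(0 <= i < n) m i * (h i * Q i)) -
    (\sum_(0 <= i < n) m i * h i) * (\sum_(0 <= i < n) m i * Q i).
  rewrite -(ler_pM2l (ltr0Sn R 1)) -!sum_mul_increments.
  apply: ler_sum => i _; apply: ler_sum => j _.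
  have [sti|/mu_out ->] := boolP (st i); last by rewrite !mul0r.
  have [stj|/mu_out ->] := boolP (st j); last by rewrite mulr0 !mul0r.
  apply: ler_wpM2l; first by apply: mulr_ge0; apply: mu_ge0.
  have -> : h j - h i = g j - g i by rewrite /h /bar; ring.
  have [ij|/ltnW ji] := leqP i j; first by rewrite -expr2 cauchy_increments.
  by rewrite -mulrNN -[leRHS]mulrNN !opprB -expr2 cauchy_increments.
apply: le_trans step1 _.
have -> : \sum_(0 <= i < n) m i * (h i * Q i) = \sum_(0 <= i < n) m i * h i * Q i.
  by apply: eq_bigr => i _; rewrite mulrA.
rewrite (summation_by_parts (fun j => m j * h j) Q).
have -> : \sum_(0 <= j < n) m j * h j = - tail g n by rewrite /tail opprK.
have T0 : 0 <= tail g n by apply: tail_ge0 => //; apply: incrE_nondecrE.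
(* At finite [n] the head of [h] need not vanish. Its contribution is [tail g n] times the
   difference of these two sides, which is nonpositive. *)
have step2 : \sum_(0 <= i < n) m i * Q i <= (\sum_(0 <= i < n) m i) * Q n.
  rewrite mulr_suml; apply: ler_sum_nat => i /andP[_ /ltnW i_n].
  by rewrite ler_wpM2l ?mu_ge0 ?Q_homo.
have step3 : - (\sum_(1 <= k < n.+1) (\sum_(0 <= j < k) m j * h j) * (Q k - Q k.-1)) <=
    c * \sum_(1 <= k < n.+1) cond k * (f k - f k.-1) ^+ 2.
  (* Termwise: the increment of [g] in [g_tail] cancels the denominator of [q]. *)
  rewrite -sumrN mulr_sumr !big_add1 /=; apply: ler_sum => k _.
  rewrite -mulNr -/(tail g k.+1) [Q k.+1]big_nat_recr //= addrAC subrr add0r /q.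
  case: ifPn => [stk|/cond_out ->]; last by rewrite mul0r !mulr0.
  have gk : 0 < g k.+1 - g k by rewrite subr_gt0 g_incr.
  rewrite /= [leLHS]mulrA ler_pdivrMr //.
  have -> : c * (cond k.+1 * (f k.+1 - f k) ^+ 2) * (g k.+1 - g k) =
      c * (cond k.+1 * (g k.+1 - g k)) * (f k.+1 - f k) ^+ 2 by ring.
  by apply: ler_wpM2r (g_tail stk); apply: sqr_ge0.
have := ler_wpM2l M0 step3; have := ler_wpM2l T0 step2.
by set x := tail g n; set S := \sum_(1 <= k < n.+1) _; lra.
Qed.

Lemma variational_lower_bound : mu_of N a b f = 0%E ->
  mu_of N a b (fun i => f i ^+ 2) = 1%E -> (D N a b f < +oo)%E ->
  1 <= c * fine (D N a b f).
Proof.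
move=> f0 f1 Df.
have u0 i : 0 <= m i * f i ^+ 2 by rewrite mulr_ge0 ?mu_ge0 ?sqr_ge0.
have c2 : cvgn (series (fun i => m i * f i ^+ 2)).
  apply: (is_cvg_sumE (mul_mu_out _)) => //.
  by move: f1; rewrite /mu_of => ->; rewrite ltry.
have l2 : limn (series (fun i => m i * f i ^+ 2)) = 1.
  have := sumE_cvg (mul_mu_out (fun i => f i ^+ 2)) 0 c2.
  by move: f1; rewrite /mu_of => ->; rewrite big_geq // subr0 => -[].
(* An equation on the limit [mu_of f] does not by itself give convergence. Absolute convergence
   follows from [|f| <= 1 + f ^+ 2] and the finite mass. *)
have c1 : cvgn (series (fun i => m i * f i)).
  apply: normed_cvg; rewrite (_ : [normed _] = series (fun i => m i * `|f i|)).
    apply: (@summable_le (fun i => `|f i|) (fun i => 1 * 1 + 1 * f i ^+ 2)).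
      move=> i _; rewrite normr_ge0 /= !mul1r -real_normK ?num_real //.
      have := sqr_ge0 (`|f i| - 1); have := sqr_ge0 `|f i|.
      by rewrite sqrrB1; lra.
    have s2 : summable_mu (fun i => f i ^+ 2) := c2.
    by have [] := summable_lin 1 1 (@summable_cst 1) s2.
  apply/funext => n; rewrite /series/=; apply: eq_bigr => i _.
  by rewrite normrM ger0_norm ?mu_ge0.
have l1 : limn (series (fun i => m i * f i)) = 0.
  have := sumE_cvg (mul_mu_out f) 0 c1.
  by move: f0; rewrite /mu_of => ->; rewrite big_geq // subr0 => -[].
have Dpart n : \sum_(1 <= k < n.+1) cond k * (f k - f k.-1) ^+ 2 <= fine (D N a b f).
  have H := sumE_ge_partial (energy_out f) 1 n.+1 (energy_ge0 f).
  rewrite -lee_fin fineK // ge0_fin_numE //; apply: le_trans H.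
  by rewrite lee_fin; apply: sumr_ge0 => i _; apply: energy_ge0.
(* The left side is the limit of the partial variances: mass times second moment minus squared first
   moment. *)
suff : Z * 1 - 0 * 0 <= Z * (c * fine (D N a b f)).
  by rewrite mul0r subr0 ler_pM2l // Z_gt0.
have cv : (series m n * series (fun i => m i * f i ^+ 2) n -
   series (fun i => m i * f i) n * series (fun i => m i * f i) n @[n --> \oo] -->
   Z * 1 - 0 * 0)%classic.
  apply: cvgB; apply: cvgM; first exact: cvg_mu.
  - by rewrite -l2.
  - by rewrite -l1.
  - by rewrite -l1.
rewrite -(cvg_lim _ cv) //; apply: limr_le; first by apply/cvg_ex; eexists; apply: cv.
apply: nearW => n; apply: le_trans (partial_variance_le n) _.
apply: ler_pM; rewrite ?sum_mu_le_Z ?ler_wpM2l //.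
- by apply: sumr_ge0 => i _; apply: mu_ge0.
- by apply: mulr_ge0 => //; apply: sumr_ge0 => i _; apply: energy_ge0.
Qed.
End Variational.

(** * The ratios I_i and the invariant of the sequence f_n *)

Lemma I_E (f : nat -> R) (i : nat) : summable_mu f ->
  I_ N a b i (br f) = ((cond i * (f i - f i.-1))%:E^-1 * (tail f i)%:E)%E.
Proof.
move=> sf; rewrite /I_ sumE_bar //; congr ((_%:E)^-1 * _)%E.
by rewrite /bar /cond; ring.
Qed.

Lemma cond_increment_gt0 (f : nat -> R) (k : nat) : st k.+1 -> f k < f k.+1 ->
  0 < cond k.+1 * (f k.+1 - f k).
Proof. by move=> stk fk; apply: mulr_gt0; rewrite ?subr_gt0 // cond_gt0. Qed.

Lemma I_finE (f : nat -> R) (k : nat) : summable_mu f -> st k.+1 -> f k < f k.+1 ->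
  I_ N a b k.+1 (br f) = (tail f k.+1 / (cond k.+1 * (f k.+1 - f k)))%:E.
Proof.
move=> sf stk fk; rewrite I_E // inver gt_eqF; last exact: cond_increment_gt0.
by rewrite -EFinM mulrC.
Qed.

Lemma gII0 (g : nat -> R) : gII N a b g 0 = 0.
Proof. by rewrite /gII big_geq. Qed.

Lemma gIIS (f : nat -> R) (k : nat) : summable_mu f ->
  gII N a b (br f) k.+1 - gII N a b (br f) k = tail f k.+1 / cond k.+1.
Proof.
move=> sf; rewrite /gII big_nat_recr //= addrAC subrr add0r.
by rewrite (sumE_bar k.+1 sf) /= mulrC.
Qed.

Hypothesis st1 : st 1.

(** The invariant carried along the f_n; its last clause is [I_i (br f) <= c] with the positive
    denominator cleared. *)
Definition admissible (c : R) (f : nat -> R) : Prop :=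
  [/\ f 0%N = 0, incrE f, summable_mu f &
    forall k, st k.+1 -> tail f k.+1 <= c * (cond k.+1 * (f k.+1 - f k))].

Lemma incr_ge0 (f : nat -> R) (i : nat) : f 0%N = 0 -> nondecrE f -> st i -> 0 <= f i.
Proof. by move=> f0 fi sti; rewrite -f0; apply: nondecrE_le. Qed.

Lemma admissible_tail_gt0 (c : R) (f : nat -> R) (k : nat) :
  admissible c f -> st k.+1 -> 0 < tail f k.+1.
Proof.
move=> [_ fi sf _] stk; apply: tail_gt0 => //; first exact: incrE_nondecrE.
exact: fi.
Qed.

(* Since the increments of F := gII (bar f) are at most c times those of f,
   [c f - F] is nondecreasing, hence has nonnegative tails. *)
Lemma admissible_gII (c : R) (f : nat -> R) :
  admissible c f -> admissible c (gII N a b (br f)).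
Proof.
move=> Af; have [f0 fi sf ft] := Af; set F := gII N a b (br f).
have dF k : F k.+1 - F k = tail f k.+1 / cond k.+1 by apply: gIIS.
have Fi : incrE F.
  move=> k stk; rewrite -subr_gt0 dF divr_gt0 ?cond_gt0 //.
  exact: admissible_tail_gt0 Af stk.
have dFle k : st k.+1 -> F k.+1 - F k <= c * (f k.+1 - f k).
  move=> stk; rewrite dF ler_pdivrMr ?cond_gt0 //.
  by rewrite -(mulrA c) (mulrC (_ - _)) ft.
have nd : nondecrE (fun i => c * f i + -1 * F i).
  by move=> k stk; have := dFle _ stk; lra.
have F0 : F 0%N = 0 by apply: gII0.
(* Domination [0 <= F <= c * f]: both sides vanish at 0 and [c f - F] is nondecreasing. *)
have sF : summable_mu F.
  apply: (@summable_le _ (fun i => c * f i + 0 * 1)); last first.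
    by have [] := summable_lin c 0 sf (@summable_cst 1).
  move=> i sti; rewrite (incr_ge0 F0 (incrE_nondecrE Fi)) //=.
  have := nondecrE_le nd (leq0n i) sti; rewrite f0 F0; lra.
split=> // k stk; rewrite dF (mulrC (cond _)) divfK ?gt_eqF ?cond_gt0 //.
have sl : summable_mu (fun i => c * f i + -1 * F i) by have [] := summable_lin c (-1) sf sF.
have := tail_ge0 k.+1 sl nd; rewrite tail_lin //; lra.
Qed.

(** Admissibility at some level [d] supplies monotonicity and summability, so only the tail clause
    is at stake. *)
Lemma admissible_supP (c d : R) (f : nat -> R) : admissible d f ->
  (ereal_sup [set I_ N a b i (br f) | i in [set i | (1 <= i)%N && st i]] <= c%:E)%E <->
  admissible c f.
Proof.
move=> [f0 fi sf _]; split=> [H|[_ _ _ ft]]; last first.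
  apply: ge_ereal_sup => _ [[//|k] /= stk <-].
  rewrite I_finE // ?fi // lee_fin ler_pdivrMr ?ft //.
  by apply: cond_increment_gt0; rewrite ?fi.
split=> // k stk.
have Ck : 0 < cond k.+1 * (f k.+1 - f k) by apply: cond_increment_gt0; rewrite ?fi.
rewrite -ler_pdivrMr // -lee_fin -I_finE ?fi //.
by apply: le_trans H; apply: ereal_sup_ubound; exists k.+1.
Qed.

(** * The constant 4 delta for the square root of [phi] *)

Section FirstTerm.
Variable d : R.
Hypothesis deltaE : delta N a b = d%:E.

Let s (i : nat) : R := Num.sqrt (phi a b i).
Let tail_mu (n : nat) : R := Z - \sum_(0 <= i < n) m i.

Let s_gt0 (i : nat) : st i.+1 -> 0 < s i.+1.
Proof. by move=> sti; rewrite sqrtr_gt0 phi_gt0. Qed.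

Let s_ge0 (i : nat) : 0 <= s i. Proof. exact: sqrtr_ge0. Qed.

Let s_sqr (i : nat) : st i -> s i ^+ 2 = phi a b i.
Proof.
move=> sti; rewrite sqr_sqrtr //; case: i sti => [|i] sti; first by rewrite phi0.
exact/ltW/phi_gt0.
Qed.

Let s_incr : incrE s.
Proof.
move=> i sti; rewrite ltr_sqrt ?phi_gt0 // phiS // ltrDl invr_gt0.
exact: cond_gt0.
Qed.

Let tail_mu_ge0 (n : nat) : 0 <= tail_mu n.
Proof. by rewrite subr_ge0 sum_mu_le_Z. Qed.

Lemma phi_sum (n : nat) : st n ->
  phi a b n = \sum_(1 <= i < n.+1) (m i * a i)^-1.
Proof.
rewrite big_add1 /=; elim: n => [|n IH] stn; first by rewrite phi0 big_geq.
by rewrite big_nat_recr //= -IH ?(state_le (leqnSn n)) // phiS.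
Qed.

Lemma delta_ge (n : nat) : st n.+1 -> s n.+1 ^+ 2 * tail_mu n.+1 <= d.
Proof.
move=> stn; rewrite s_sqr // phi_sum // -lee_fin -deltaE.
apply: ereal_sup_ubound; exists n.+1 => //=.
by rewrite (sumE_cvg mu_out _ cvg_mu).
Qed.

(* Writing m_j = tail_mu j - tail_mu (j + 1), the sum telescopes thanks to
   tail_mu j (s_j - s_(j-1)) <= d / s_(j-1) - d / s_j. *)
Lemma sum_mu_sqrt_phi (i n : nat) : (i < n)%N -> st n ->
  \sum_(i.+1 <= j < n.+1) m j * s j <=
    2 * d / s i.+1 - d / s n - tail_mu n.+1 * s n.
Proof.
elim: n => [//|n IH]; rewrite ltnS leq_eqVlt => /predU1P[<-|i_n] stn.
  have tE : m i.+1 = tail_mu i.+1 - tail_mu i.+2.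
    by rewrite /tail_mu [in X in _ - X]big_nat_recr //=; ring.
  rewrite big_nat1 tE.
  have si := s_gt0 stn.
  have : tail_mu i.+1 * s i.+1 <= d / s i.+1.
    by rewrite ler_pdivlMr // -mulrA -expr2 mulrC delta_ge.
  by lra.
case: n => // n in IH i_n stn *.
have stn' := state_le (leqnSn n.+1) stn.
rewrite big_nat_recr //=; last by rewrite ltnS ltnW.
have {IH} := IH i_n stn'.
have tE : m n.+2 = tail_mu n.+2 - tail_mu n.+3.
  by rewrite /tail_mu [in X in _ - X]big_nat_recr //=; ring.
have sn := s_gt0 stn; have sn' := s_gt0 stn'; have ss := s_incr stn.
have : tail_mu n.+2 * (s n.+2 - s n.+1) <= d / s n.+1 - d / s n.+2.
  have -> : d / s n.+1 - d / s n.+2 = d / (s n.+1 * s n.+2) * (s n.+2 - s n.+1).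
    by field; rewrite !gt_eqF.
  (* It remains to see that [tail_mu n.+2 * s n.+1 * s n.+2 <= d], which follows from
     [s n.+1 <= s n.+2] and [delta_ge]. *)
  apply: ler_wpM2r; first by rewrite subr_ge0 ltW.
  rewrite ler_pdivlMr ?mulr_gt0 //; apply: le_trans (delta_ge stn).
  rewrite [leRHS]mulrC; apply: ler_wpM2l; first exact: tail_mu_ge0.
  by rewrite expr2 ler_pM2r // ltW.
by rewrite tE; lra.
Qed.

Lemma d_ge0 : 0 <= d.
Proof. by apply: le_trans (delta_ge st1); rewrite mulr_ge0 ?sqr_ge0. Qed.

Lemma sum_mu_sqrt_phi_le (i n : nat) : st i.+1 ->
  \sum_(i.+1 <= j < n) m j * s j <= 2 * d / s i.+1.
Proof.
move=> sti; have si := s_gt0 sti.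
have B : 0 <= 2 * d / s i.+1 by rewrite divr_ge0 ?mulr_ge0 ?d_ge0.
(* The induction serves to pass the indices beyond E, where the summands vanish. *)
elim: n => [|n IH]; first by rewrite big_geq.
have [i_n|n_i] := ltnP i n; last by rewrite big_geq.
have [stn|stn] := boolP (st n); last first.
  by rewrite big_nat_recr //= (mul_mu_out _ stn) addr0.
apply: le_trans (sum_mu_sqrt_phi i_n stn) _.
have := mulr_ge0 (tail_mu_ge0 n.+1) (s_ge0 n); have := divr_ge0 d_ge0 (s_ge0 n); lra.
Qed.

Lemma summable_sqrt_phi : summable_mu s.
Proof.
apply: nondecreasing_is_cvgn.
  by apply: nondecreasing_series => i _ _; rewrite mulr_ge0 ?mu_ge0.
exists (2 * d / s 1) => _ [n _ <-].
apply: le_trans (sum_mu_sqrt_phi_le n st1); rewrite /series/=.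
case: n => [|n]; first by rewrite !big_geq.
by rewrite big_nat_recl // big_add1 /= /s phi0 sqrtr0 mulr0 add0r.
Qed.

(** Centering subtracts the nonnegative mean [L / Z] times the tail mass, so the uncentered tail is
    an upper bound. *)
Lemma tail_sqrt_phi_le (i : nat) : st i.+1 -> tail s i.+1 <= 2 * d / s i.+1.
Proof.
move=> sti; set L := limn (series (fun i => m i * s i)).
have L0 : 0 <= L.
  apply: limr_ge; first exact: summable_sqrt_phi.
  by apply: nearW => n; apply: sumr_ge0 => j _; rewrite mulr_ge0 ?mu_ge0.
have -> : tail s i.+1 = L - \sum_(0 <= j < i.+1) m j * s j - L / Z * tail_mu i.+1.
  rewrite /tail /bar prob_ofE; last exact: summable_sqrt_phi.
  rewrite -/L /tail_mu; under eq_bigr do rewrite mulrBr.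
  by rewrite sumrB -mulr_suml; field; rewrite gt_eqF ?Z_gt0.
have : 0 <= L / Z * tail_mu i.+1 by rewrite mulr_ge0 // divr_ge0 // ltW ?Z_gt0.
suff : L <= \sum_(0 <= j < i.+1) m j * s j + 2 * d / s i.+1 by lra.
apply: limr_le; first exact: summable_sqrt_phi.
near=> n; rewrite /series/= (@big_cat_nat _ _ _ i.+1) //=; last first.
  by near: n; apply: nbhs_infty_ge.
by rewrite lerD2l sum_mu_sqrt_phi_le.
Unshelve. all: by end_near. Qed.

Lemma admissible_sqrt_phi : admissible (4 * d) s.
Proof.
split; [by rewrite /s phi0 sqrtr0|exact: s_incr|exact: summable_sqrt_phi|].
move=> i sti; apply: le_trans (tail_sqrt_phi_le sti) _.
have si := s_gt0 sti; have ss := s_incr sti; have s0 := s_ge0 i.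
have ci := cond_gt0 (ltn0Sn i) sti.
(* The squares of [s] differ by [(cond i.+1)^-1]. Since [s i.+1 + s i <= 2 * s i.+1], the constant
   [2 * d] becomes [4 * d]. *)
have E : cond i.+1 * (s i.+1 - s i) = (s i.+1 + s i)^-1.
  apply: (mulIf (x := s i.+1 + s i)); first by rewrite gt_eqF // ltr_pwDl.
  rewrite mulVf ?gt_eqF ?ltr_pwDl // -mulrA -subr_sqr !s_sqr ?(state_le (leqnSn i)) //.
  by rewrite phiS // addrAC subrr add0r mulfV // gt_eqF.
rewrite E ler_pdivrMr // mulrAC ler_pdivlMr; last by rewrite ltr_pwDl.
have := d_ge0; have := mulr_ge0 d_ge0 (ltW (_ : 0 < s i.+1 - s i)).
by rewrite subr_gt0 => /(_ ss); lra.
Qed.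

End FirstTerm.

(** * Functions stopped at [r], the index m of the theorem, and upper bounds for lambda1 *)

Section Stopped.
Variable r : nat.
Hypothesis r_gt0 : (0 < r)%N.
Hypothesis st_r : st r.

Definition stopped (f : nat -> R) : Prop :=
  [/\ f 0%N = 0, forall k, (k < r)%N -> f k < f k.+1 &
    forall i, f i = f (minn i r)].

Let st_lt (k : nat) : (k < r)%N -> st k.+1.
Proof. by move=> kr; apply: state_le st_r. Qed.

Lemma stopped_cst (f : nat -> R) (i : nat) : stopped f -> (r <= i)%N -> f i = f r.
Proof. by move=> [_ _ fr] /minn_idPr ri; rewrite fr ri. Qed.

Lemma stopped_increment0 (f : nat -> R) (k : nat) :
  stopped f -> (r <= k)%N -> f k.+1 - f k = 0.
Proof.
by move=> sf rk; rewrite !(stopped_cst sf) ?subrr //; apply: leqW.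
Qed.

Lemma stopped_nondecr (f : nat -> R) : stopped f -> nondecrE f.
Proof.
move=> sf k _; have [kr|rk] := ltnP k r; first by case: sf => _ /(_ _ kr)/ltW.
by rewrite -subr_ge0 stopped_increment0.
Qed.

Lemma stopped_summable (f : nat -> R) : stopped f -> summable_mu f.
Proof.
move=> sf; apply: (@summable_le _ (fun=> f r)); last exact: summable_cst.
have [f0 _ fr] := sf; move=> i sti.
rewrite incr_ge0 //=; last exact: stopped_nondecr.
by rewrite fr; apply: nondecrE_le => //; [exact: stopped_nondecr|exact: geq_minr].
Qed.

Lemma stopped_tail_gt0 (f : nat -> R) (k : nat) : stopped f -> st k.+1 -> 0 < tail f k.+1.
Proof.
move=> sf stk; apply: tail_gt0 => //; [exact: stopped_summable|exact: stopped_nondecr|].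
by case: sf => _ /(_ _ r_gt0).
Qed.

Lemma stopped_phi : stopped (stop r (phi a b)).
Proof.
split=> [|k kr|i]; rewrite /stop ?min0n ?phi0 //; last by rewrite -minnA minnn.
rewrite (minn_idPl (ltnW kr)) (minn_idPl kr) phiS; last exact: st_lt.
by rewrite ltrDl invr_gt0 cond_gt0 // st_lt.
Qed.

Lemma stopped_gII_increment (f : nat -> R) (k : nat) : stopped f -> (k < r)%N ->
  stop r (gII N a b (br f)) k.+1 - stop r (gII N a b (br f)) k = tail f k.+1 / cond k.+1.
Proof.
move=> sf kr; rewrite /stop (minn_idPl (ltnW kr)) (minn_idPl kr) gIIS //.
exact: stopped_summable.
Qed.

Lemma stopped_gII (f : nat -> R) : stopped f -> stopped (stop r (gII N a b (br f))).
Proof.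
move=> sf; split=> [|k kr|i]; last by rewrite /stop -minnA minnn.
  by rewrite /stop min0n gII0.
rewrite -subr_gt0 stopped_gII_increment // divr_gt0 ?cond_gt0 ?st_lt //.
by apply: stopped_tail_gt0 => //; apply: st_lt.
Qed.

(** Restricted to [k < r], as the increments vanish from [r] on and I_i is then infinite. *)
Definition tail_lower_bound (c : R) (f : nat -> R) : Prop :=
  forall k, (k < r)%N -> c * (cond k.+1 * (f k.+1 - f k)) <= tail f k.+1.

(** Here [F - c f] is nondecreasing: up to [r] by the hypothesis on the tails of [f], afterwards
    because both are constant. Its tails are therefore nonnegative. *)
Lemma tail_lower_bound_gII (c : R) (f : nat -> R) : stopped f ->
  tail_lower_bound c f -> tail_lower_bound c (stop r (gII N a b (br f))).
Proof.
move=> sf ft; set F := stop r _; have sF : stopped F := stopped_gII sf.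
have dF k : (k < r)%N -> F k.+1 - F k = tail f k.+1 / cond k.+1.
  by move=> kr; apply: stopped_gII_increment.
have nd : nondecrE (fun i => 1 * F i + - c * f i).
  move=> k stk; have [kr|rk] := ltnP k r; last first.
    by have := stopped_increment0 sF rk; have := stopped_increment0 sf rk;
      move=> /subr0_eq -> /subr0_eq ->.
  suff : c * (f k.+1 - f k) <= F k.+1 - F k by lra.
  rewrite dF // ler_pdivlMr ?cond_gt0 ?st_lt //.
  by rewrite -(mulrA c) (mulrC (_ - _)) ft.
have sumf := stopped_summable sf; have sumF := stopped_summable sF.
move=> k kr; rewrite dF // (mulrC (cond _)) divfK ?gt_eqF ?cond_gt0 ?st_lt //.
have sl : summable_mu (fun i => 1 * F i + - c * f i) by have [] := summable_lin 1 (- c) sumF sumf.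
have := tail_ge0 k.+1 sl nd; rewrite tail_lin //; lra.
Qed.

Local Notation infI f :=
  (ereal_inf [set I_ N a b i (br f) | i in [set i | (1 <= i)%N && st i]])%classic.

(** The factor [0^-1 = +oo] meets a strictly positive tail; a zero tail would give the product 0
    instead. *)
Lemma I_stopped (f : nat -> R) (k : nat) : stopped f -> (r <= k)%N -> st k.+1 ->
  I_ N a b k.+1 (br f) = +oo%E.
Proof.
move=> sf rk stk; rewrite I_E ?stopped_increment0 ?mulr0 ?inver ?eqxx //.
  by rewrite gt0_mulye // lte_fin stopped_tail_gt0.
exact: stopped_summable.
Qed.

Lemma infI_geP (c : R) (f : nat -> R) : stopped f ->
  (c%:E <= infI f)%E <-> tail_lower_bound c f.
Proof.
move=> sf; have [_ fi _] := sf; have sumf := stopped_summable sf; split=> [H k kr|ft].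
  have Ck : 0 < cond k.+1 * (f k.+1 - f k) by apply: cond_increment_gt0; rewrite ?st_lt ?fi.
  rewrite -ler_pdivlMr // -lee_fin -I_finE ?fi ?st_lt //.
  by apply: le_trans H _; apply: ereal_inf_lbound; exists k.+1 => //=; apply: st_lt.
apply: le_ereal_inf_tmp => _ [[//|k] /= stk <-].
have [kr|rk] := ltnP k r; last by rewrite I_stopped ?leey.
rewrite I_finE // ?fi // lee_fin ler_pdivlMr ?ft //.
by apply: cond_increment_gt0; rewrite ?fi.
Qed.

(** The ratio at 1 is finite and all tails are positive. The real value is the constant handed on to
    later iterates. *)
Lemma infI_fin (f : nat -> R) : stopped f -> exists2 c, 0 <= c & infI f = c%:E.
Proof.
move=> sf; have [_ fi _] := sf; have sumf := stopped_summable sf.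
have lo : (0%:E <= infI f)%E.
  apply/infI_geP => // k kr; rewrite mul0r ltW // stopped_tail_gt0 //.
  exact: st_lt.
have up : (infI f < +oo)%E.
  apply: (@le_lt_trans _ _ (I_ N a b 1 (br f))).
    by apply: ereal_inf_lbound; exists 1%N.
  by rewrite I_finE ?fi ?ltry.
have fin : infI f \is a fin_num by rewrite ge0_fin_numE.
by exists (fine (infI f)); rewrite ?fineK // fine_ge0.
Qed.

Definition energy (f : nat -> R) : R := \sum_(0 <= k < r) cond k.+1 * (f k.+1 - f k) ^+ 2.
(** For stopped [f], the summation-by-parts form of mu((bar f)^2). *)
Definition variance (f : nat -> R) : R := \sum_(0 <= k < r) tail f k.+1 * (f k.+1 - f k).

Lemma cvg_energy (f : nat -> R) : stopped f ->
  (series (fun i => m i * a i * (f i - f i.-1) ^+ 2) @ \oo --> energy f)%classic.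
Proof.
move=> sf; have -> : energy f =
    \sum_(0 <= i < r.+1) m i * a i * (f i - f i.-1) ^+ 2.
  by rewrite big_nat_recl //= subrr expr2 !mulr0 add0r.
apply: cvg_series_eventually0 => -[//|i] ri.
by rewrite [i.+1.-1]/= stopped_increment0 // expr2 !mulr0.
Qed.

Lemma D_stopped (f : nat -> R) : stopped f -> D N a b f = (energy f)%:E.
Proof.
move=> sf; rewrite /D (sumE_cvg (energy_out f) 1 (cvg_energy sf)) big_nat1.
by rewrite subrr expr2 !mulr0 subr0.
Qed.

(** The boundary term of the summation by parts tends to 0, since [br f] has total mass 0 and is
    constant from [r] on. *)
Lemma cvg_variance (f : nat -> R) : stopped f ->
  (series (fun i => m i * br f i ^+ 2) @ \oo --> variance f)%classic.
Proof.
move=> sf; have sumf := stopped_summable sf.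
rewrite (_ : series _ = fun n => series (fun i => m i * br f i) n * br f n +
    series (fun k => tail f k.+1 * (f k.+1 - f k)) n); last first.
  apply/funext => n; rewrite /series/=.
  transitivity (\sum_(0 <= j < n) m j * br f j * br f j).
    by apply: eq_bigr => j _; rewrite expr2 mulrA.
  rewrite (summation_by_parts (fun j => m j * br f j)) big_add1 /= -sumrN.
  congr (_ + _); apply: eq_bigr => k _; rewrite -mulNr; congr (_ * _).
  by rewrite /bar; ring.
rewrite -[variance f]add0r -[X in X + _](mul0r (br f r)).
apply: cvgD; last first.
  by apply: cvg_series_eventually0 => k rk; rewrite stopped_increment0 ?mulr0.
apply: cvgM; first exact: cvg_bar.
apply: cvg_near_cst; near=> n; rewrite /bar (stopped_cst sf) //.
by near: n; apply: nbhs_infty_ge.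
Unshelve. all: by end_near. Qed.

Lemma variance_stopped (f : nat -> R) : stopped f ->
  mu_of N a b (fun i => br f i ^+ 2) = (variance f)%:E.
Proof.
move=> sf; rewrite /mu_of (sumE_cvg (mul_mu_out _) 0 (cvg_variance sf)).
by rewrite big_geq // subr0.
Qed.

Lemma sum_r_gt0 (u : nat -> R) : (forall k, (k < r)%N -> 0 < u k) -> 0 < \sum_(0 <= k < r) u k.
Proof.
move=> u0; rewrite big_ltn // ltr_pwDl ?u0 // big_seq; apply: sumr_ge0 => k.
by rewrite mem_index_iota => /andP[_ /u0/ltW].
Qed.

Lemma energy_gt0 (f : nat -> R) : stopped f -> 0 < energy f.
Proof.
move=> [_ fi _]; apply: sum_r_gt0 => k kr; rewrite mulr_gt0 ?cond_gt0 ?st_lt //.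
by rewrite exprn_gt0 // subr_gt0 fi.
Qed.

Lemma variance_gt0 (f : nat -> R) : stopped f -> 0 < variance f.
Proof.
move=> sf; apply: sum_r_gt0 => k kr; rewrite mulr_gt0 ?stopped_tail_gt0 ?st_lt //.
by case: sf => _ fi _; rewrite subr_gt0 fi.
Qed.

Lemma quotient_stopped (f : nat -> R) : stopped f ->
  (mu_of N a b (fun i => (br f i ^+ 2)%R) / D N a b f)%E = (variance f / energy f)%:E.
Proof.
move=> sf; rewrite variance_stopped // D_stopped // inver gt_eqF ?energy_gt0 //.
Qed.

Lemma tail_lower_bound_quotient (c : R) (f : nat -> R) : stopped f ->
  tail_lower_bound c f -> c <= variance f / energy f.
Proof.
move=> sf ft; rewrite ler_pdivlMr ?energy_gt0 // mulr_sumr; apply: ler_sum_nat => k /= kr.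
have [_ fi _] := sf.
have -> : c * (cond k.+1 * (f k.+1 - f k) ^+ 2) =
  c * (cond k.+1 * (f k.+1 - f k)) * (f k.+1 - f k) by ring.
apply: ler_wpM2r; last exact: ft.
by rewrite subr_ge0 ltW // fi.
Qed.

Lemma lambda1_le_stopped (f : nat -> R) : stopped f ->
  (lambda1 N a b <= (energy f / variance f)%:E)%E.
Proof.
move=> sf; have V0 := variance_gt0 sf; set s := Num.sqrt (variance f).
have sV : s ^- 2 = (variance f)^-1 by rewrite sqr_sqrtr // ltW.
(* The centered function scaled to mu(g^2) = 1, a competitor in the infimum defining [lambda1]. *)
pose g i := s^-1 * br f i.
have sumf := stopped_summable sf.
have E : D N a b g = (energy f / variance f)%:E.
  rewrite /D (sumE_cvg (energy_out g) 1 (l := energy f / variance f)).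
    by rewrite big_nat1 subrr expr2 !mulr0 subr0.
  rewrite (_ : series _ = fun n =>
      series (fun i => m i * a i * (f i - f i.-1) ^+ 2) n * (variance f)^-1).
    by apply: cvgM; [exact: cvg_energy|exact: cvg_cst].
  apply/funext => n; rewrite /series/= mulr_suml; apply: eq_bigr => i _.
  by rewrite /g -mulrBr exprMn exprVn sV /bar; ring.
rewrite -E; apply: ereal_inf_lbound; exists g => //; split; last split.
- rewrite /mu_of (sumE_cvg (mul_mu_out _) 0 (l := s^-1 * 0)).
    by rewrite big_geq // mulr0 subr0.
  rewrite (_ : series _ = fun n => s^-1 * series (fun i => m i * br f i) n).
    by apply: cvgM; [exact: cvg_cst|exact: cvg_bar].
  apply/funext => n; rewrite /series/= mulr_sumr; apply: eq_bigr => i _.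
  by rewrite /g; ring.
- rewrite /mu_of (sumE_cvg (mul_mu_out _) 0 (l := (variance f)^-1 * variance f)).
    by rewrite big_geq // subr0 mulVf // gt_eqF.
  rewrite (_ : series _ = fun n => (variance f)^-1 * series (fun i => m i * br f i ^+ 2) n).
    by apply: cvgM; [exact: cvg_cst|exact: cvg_variance].
  apply/funext => n; rewrite /series/= mulr_sumr; apply: eq_bigr => i _.
  by rewrite /g exprMn exprVn sV; ring.
- by rewrite E ltry.
Qed.

End Stopped.

(** * Monotonicity of eta_n and its comparison with lambda1 and delta *)

Section EtaSequence.
Hypothesis delta_fin : (delta N a b < +oo)%E.

Local Notation d := (fine (delta N a b)).

Lemma delta_finE : delta N a b = d%:E.
Proof.
rewrite fineK // ge0_fin_numE //.
apply: (@le_trans _ _ ((\sum_(1 <= i < 2) (m i * a i)^-1)%:E * sumE N 1 m)%E); last first.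
  by apply: ereal_sup_ubound; exists 1%N.
rewrite (sumE_cvg mu_out 1 cvg_mu) -EFinM lee_fin big_nat1 mulr_ge0 //.
  by rewrite invr_ge0 ltW // (@cond_gt0 1).
by rewrite subr_ge0 sum_mu_le_Z.
Qed.

Lemma admissible_f_ (c : R) (p q : nat) : (1 <= p)%N -> (p <= q)%N ->
  admissible c (f_ N a b p) -> admissible c (f_ N a b q).
Proof.
move=> p1; elim: q => [|q IH]; first by case: p p1.
rewrite leq_eqVlt => /predU1P[-> //|pq] Ap.
(* [f_] iterates [n.-1] times, so the recursion unfolds only from index 2 on; index 1 would force
   [p < 1]. *)
case: q => [|q] in IH pq *; first by move: pq; rewrite ltnS leqNgt p1.
by apply: admissible_gII; apply: IH.
Qed.

(** The bound [4 * d] is inherited from the first term, so eta_n is finite; it is positive because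
    I_1 is, which makes the inverses real. *)
Lemma eta_admissible (n : nat) : (1 <= n)%N ->
  exists2 c, 0 < c <= 4 * d & eta N a b n = c%:E /\ admissible c (f_ N a b n).
Proof.
move=> n1; have A1 : admissible (4 * d) (f_ N a b 1) := admissible_sqrt_phi delta_finE.
have An := admissible_f_ (leqnn 1) n1 A1.
have up := (admissible_supP _ An).2 An.
have [_ fi sf _] := An.
have I1 : (0%:E < I_ N a b 1 (br (f_ N a b n)))%E.
  rewrite I_finE ?fi // lte_fin divr_gt0 ?cond_increment_gt0 ?fi //.
  exact: admissible_tail_gt0 An st1.
have lo : (0%:E < eta N a b n)%E.
  by apply: lt_le_trans I1 _; apply: ereal_sup_ubound; exists 1%N.
have fin : eta N a b n \is a fin_num.
  by rewrite gt0_fin_numE //; apply: le_lt_trans up _; rewrite ltry.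
exists (fine (eta N a b n)).
  by rewrite -!lte_fin -lee_fin fineK // lo.
by rewrite fineK //; split => //; apply/(admissible_supP _ An); rewrite fineK.
Qed.

Lemma eta_nonincreasing (p q : nat) : (1 <= p)%N -> (p <= q)%N ->
  (eta N a b q <= eta N a b p)%E.
Proof.
move=> p1 pq; have [c _ [-> Ap]] := eta_admissible p1.
by have Aq := admissible_f_ p1 pq Ap; apply/(admissible_supP _ Aq).
Qed.

Lemma eta_lambda1 (n : nat) : (1 <= n)%N ->
  ((eta N a b n)^-1 <= lambda1 N a b)%E /\
  ((4%:E * delta N a b)^-1 <= (eta N a b n)^-1)%E.
Proof.
move=> n1; have [c /andP[c0 c4] [-> [_ fi sf ft]]] := eta_admissible n1.
split; last first.
  by rewrite delta_finE -EFinM lee_pV2 ?inE ?lee_fin // ltW // (lt_le_trans c0).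
rewrite inver gt_eqF //; apply: le_ereal_inf_tmp => _ [g [g0 [g1 Dg]] <-].
have := variational_lower_bound (ltW c0) sf fi ft g0 g1 Dg.
rewrite -ler_pdivrMl // mulr1 -lee_fin fineK // ge0_fin_numE //.
apply: le_trans (sumE_ge_partial (energy_out g) 1 1 (energy_ge0 g)).
by rewrite big_geq.
Qed.

End EtaSequence.

(** * Monotonicity of eta'_n and the comparison of eta', etabar and lambda1 *)

Lemma stopped_fm_ (r n : nat) : (0 < r)%N -> st r -> stopped r (fm_ N a b r n).
Proof.
move=> r0 str; rewrite /fm_; elim: n.-1 => [|k IH]; first exact: stopped_phi.
exact: stopped_gII.
Qed.

Lemma tail_lower_bound_fm_ (r : nat) (c : R) (p q : nat) : (0 < r)%N -> st r ->
  (1 <= p)%N -> (p <= q)%N ->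
  tail_lower_bound r c (fm_ N a b r p) -> tail_lower_bound r c (fm_ N a b r q).
Proof.
move=> r0 str p1; elim: q => [|q IH]; first by case: p p1.
rewrite leq_eqVlt => /predU1P[-> //|pq] Ap.
case: q => [|q] in IH pq *; first by move: pq; rewrite ltnS leqNgt p1.
by apply: (tail_lower_bound_gII r0 str (stopped_fm_ q.+1 r0 str)); apply: IH.
Qed.

(** The infima increase for each stopping index separately, hence so do their suprema. *)
Lemma eta'_nondecreasing (p q : nat) : (1 <= p)%N -> (p <= q)%N ->
  (eta' N a b p <= eta' N a b q)%E.
Proof.
move=> p1 pq; apply: ge_ereal_sup => _ [r /= /andP[r0 str] <-].
apply: le_trans (ereal_sup_ubound _); last by exists r => //=; apply/andP.
have [c _ cE] := infI_fin r0 str (stopped_fm_ p r0 str).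
rewrite cE; apply/(infI_geP r0 str _ (stopped_fm_ q r0 str)).
apply: tail_lower_bound_fm_ pq _ => //.
by apply/(infI_geP r0 str _ (stopped_fm_ p r0 str)); rewrite cE.
Qed.

Lemma eta'_ge0 (n : nat) : (0 <= eta' N a b n)%E.
Proof.
have [c c0 cE] := infI_fin (ltn0Sn 0) st1 (stopped_fm_ n (ltn0Sn 0) st1).
apply: (@le_trans _ _ c%:E); first by rewrite lee_fin.
by rewrite -cE; apply: ereal_sup_ubound; exists 1%N.
Qed.

Lemma eta'_le_etabar (n : nat) : (eta' N a b n <= etabar N a b n)%E.
Proof.
apply: ge_ereal_sup => _ [r /= /andP[r0 str] <-].
apply: le_trans (ereal_sup_ubound _); last by exists r => //=; apply/andP.
have sf := stopped_fm_ n r0 str; have [c _ cE] := infI_fin r0 str sf.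
rewrite (quotient_stopped r0 str sf) cE lee_fin; apply: tail_lower_bound_quotient => //.
by apply/(infI_geP r0 str _ sf); rewrite cE.
Qed.

Lemma lambda1_ge0 : (0 <= lambda1 N a b)%E.
Proof.
apply: le_ereal_inf_tmp => _ [g _ <-].
apply: le_trans (sumE_ge_partial (energy_out g) 1 1 (energy_ge0 g)).
by rewrite big_geq.
Qed.

(** Each quotient is the inverse of the Rayleigh quotient of a test function. Inverting in the
    extended reals gives a bound uniform in the stopping index. *)
Lemma etabar_le_inv_lambda1 (n : nat) : (etabar N a b n <= (lambda1 N a b)^-1)%E.
Proof.
apply: ge_ereal_sup => _ [r /= /andP[r0 str] <-].
have sf := stopped_fm_ n r0 str; rewrite (quotient_stopped r0 str sf).
have V0 := variance_gt0 r0 str sf; have E0 := energy_gt0 r0 str sf.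
have q0 := divr_gt0 V0 E0.
rewrite inve_pge ?inE ?lambda1_ge0 ?lee_fin ?(ltW q0) // inver gt_eqF // invf_div.
exact: (lambda1_le_stopped r0 str sf).
Qed.

Lemma etabar_lambda1 (n : nat) :
  ((etabar N a b n)^-1 <= (eta' N a b n)^-1)%E /\
  (lambda1 N a b <= (etabar N a b n)^-1)%E.
Proof.
have e0 := eta'_ge0 n; have ee := eta'_le_etabar n; have b0 := le_trans e0 ee.
split; first by rewrite lee_pV2 ?inE.
by rewrite inve_pge ?inE ?lambda1_ge0 //; apply: etabar_le_inv_lambda1.
Qed.

End Chain.

Unset Implicit Arguments.

Theorem theorem6p3 (R : realType) (N : option nat) (a b : nat -> R)
    (N_ge1 : if N is Some n then (1 <= n)%N else true)
    (b_gt0 : forall i : nat, nontop N i -> 0 < b i)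
    (b_top : forall n : nat, N = Some n -> b n = 0)
    (a_gt0 : forall i : nat, (1 <= i)%N -> state N i -> 0 < a i)
    (a0 : a 0%N = 0)
    (mass_fin : (mass N a b < +oo)%E)
    (delta_fin : (delta N a b < +oo)%E) :
  ((forall p q : nat, (1 <= p)%N -> (p <= q)%N ->
      (eta N a b q <= eta N a b p)%E) /\
   (forall n : nat, (1 <= n)%N ->
      ((eta N a b n)^-1 <= lambda1 N a b)%E /\
      ((4%:E * delta N a b)^-1 <= (eta N a b n)^-1)%E)) /\
  ((forall p q : nat, (1 <= p)%N -> (p <= q)%N ->
      (eta' N a b p <= eta' N a b q)%E) /\
   (forall n : nat, (1 <= n)%N ->
      ((etabar N a b n)^-1 <= (eta' N a b n)^-1)%E /\
      (lambda1 N a b <= (etabar N a b n)^-1)%E)).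
Proof.
have st1 : state N 1 := N_ge1.
split; split.
- by move=> p q; apply: eta_nonincreasing.
- by move=> n; apply: eta_lambda1.
- by move=> p q; apply: eta'_nondecreasing.
- by move=> n _; apply: etabar_lambda1.
Qed.
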